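(* Suppose $(C,k)$ is feasible, i.e. $k\le p$ and $C\ge w_{\min}\sum_{i=1}^kc_{(i)}$, where $c_{(1)}\le\cdots\le c_{(p)}$ are the ordered candidate costs. Then every reachable state $\mathcal X_l$ with $l\in\{1,\dots,k\}$ has $\mathcal F_l\ne\varnothing$ and $k_{\mathrm{rem}}^{(l-1)}\ge1$, and, with $\rho_l$ the local policy ratio at $\mathcal X_l$, the greedy edge $e_l^\star$ satisfies: (i) $\displaystyle\Delta R_{\mathrm{tot}}^{(l)}(e_l^\star)\ge\frac{\rho_l}{k_{\mathrm{rem}}^{(l-1)}}V_l(\mathcal X_l)$; (ii) $\displaystyle V_{l+1}\bigl(f(\mathcal X_l,e_l^\star)\bigr)\le\Bigl(1-\frac{\rho_l}{k_{\mathrm{rem}}^{(l-1)}}\Bigr)V_l(\mathcal X_l)$; (iii) $0\le G_l(\mathcal X_l)\le V_l(\mathcal X_l)$. Moreover, along the realized greedy trajectory $\mathcal X_{t+1}=f(\mathcal X_t,e_t^\star)$ one has, for every $m\in\{l,\dots,k\}$, $$V_{m+1}(\mathcal X_{m+1})\le\prod_{t=l}^m\Bigl(1-\frac{\rho_t}{k_{\mathrm{rem}}^{(t-1)}}\Bigr)V_l(\mathcal X_l).$$ If, in addition, $\rho_t\ge\rho_{\min}>0$ for all $t$ (for some constant $\rho_{\min}$), then $k_{\mathrm{rem}}^{(t-1)}=k-(t-1)$ and $$V_{m+1}(\mathcal X_{m+1})\le e^{-\rho_{\min}(H_{k-l+1}-H_{k-m})}\,V_l(\mathcal X_l),$$ where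 $H_q:=\sum_{j=1}^q\frac1j$ and $H_0:=0$.
   Context: Setting. $\mathcal G$ is an undirected connected graph on $n$ nodes $v_1,\dots,v_n$ with base edge set $\mathcal E_{\mathrm b}$ (no self-loops), fixed positive base edge weights and weighted Laplacian $\mathbf L_{\mathrm b}$. $\mathcal E_{\mathrm c}$ is a set of $p$ candidate edges (unordered pairs of distinct nodes, disjoint from $\mathcal E_{\mathrm b}$) with per-unit costs $0<c_e<\infty$. For $e=\{v_i,v_j\}$, $\mathbf a_e\in\mathbb R^n$ has $i$-th entry $1$, $j$-th entry $-1$ (arbitrary orientation), zeros elsewhere. Budget $C>0$, target cardinality $k\ge1$ (integer), weight bounds $0<w_{\min}\le w_{\max}$. States. For $l\in\{1,\dots,k\}$ a state is $\mathcal X_l=(\mathbf M'_{l-1},\mathcal E_{\mathrm{rem}}^{(l-1)},\mathcal E_{\mathrm{used}}^{(l-1)},C_{\mathrm{rem}}^{(l-1)})$: current shifted Laplacian, remaining candidates, used candidates, remaining budget; $k_{\mathrm{rem}}^{(l-1)}:=k-|\mathcal E_{\mathrm{used}}^{(l-1)}|$. The initial state is $\mathcal X_1=(\mathbf L_{\mathrm b}+\frac1n\mathbf 1\mathbf 1^\top,\mathcal E_{\mathrm c},\emptyset,C)$. Reserve and feasible actions. With $r=k_{\mathrm{rem}}^{(l-1)}$, $R_e^{(l)}$ is $w_{\min}$ times the sum of the $r-1$ smallest costs among edges of $\mathcal E_{\mathrm{rem}}^{(l-1)}\setminus\{e\}$ ($R_e^{(l)}:=0$ when $r=1$). The feasible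 action set is $$\mathcal F_l:=\{e\in\mathcal E_{\mathrm{rem}}^{(l-1)}: c_ew_{\min}\le C_{\mathrm{rem}}^{(l-1)}-R_e^{(l)}\}.$$ Weights and gains. For $e\in\mathcal F_l$, with $s=C_{\mathrm{rem}}^{(l-1)}/k_{\mathrm{rem}}^{(l-1)}$, the reserve-capped trial weight is $$w_e^{(l)}=\min\Bigl\{\max\bigl\{w_{\min},\min\{w_{\max},s/c_e\}\bigr\},\frac{C_{\mathrm{rem}}^{(l-1)}-R_e^{(l)}}{c_e}\Bigr\},$$ and the one-step gain is $$\Delta R_{\mathrm{tot}}^{(l)}(e)=\frac{n\,w_e^{(l)}(b_e^2)^{(l)}}{1+w_e^{(l)}r_e^{(l)}},\quad r_e^{(l)}=\mathbf a_e^\top(\mathbf M'_{l-1})^{-1}\mathbf a_e,\quad (b_e^2)^{(l)}=\|(\mathbf M'_{l-1})^{-1}\mathbf a_e\|_2^2.$$ Transition. $f(\mathcal X_l,e)$, $e\in\mathcal F_l$, is the state $\mathcal X_{l+1}$ with $\mathbf M'_l=\mathbf M'_{l-1}+w_e^{(l)}\mathbf a_e\mathbf a_e^\top$, $\mathcal E_{\mathrm{rem}}^{(l)}=\mathcal E_{\mathrm{rem}}^{(l-1)}\setminus\{e\}$, $\mathcal E_{\mathrm{used}}^{(l)}=\mathcal E_{\mathrm{used}}^{(l-1)}\cup\{e\}$, $C_{\mathrm{rem}}^{(l)}=C_{\mathrm{rem}}^{(l-1)}-c_ew_e^{(l)}$. A state is reachable if it is obtained from $\mathcal X_1$ by successive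 transitions with feasible actions. Value functions. $V_{k+1}:=0$, $G_{k+1}:=0$. For $l\le k$, $V_l(\mathcal X_l)=G_l(\mathcal X_l)=0$ if $\mathcal F_l=\varnothing$ or $k_{\mathrm{rem}}^{(l-1)}=0$; otherwise $$V_l(\mathcal X_l)=\max_{e\in\mathcal F_l}\{\Delta R_{\mathrm{tot}}^{(l)}(e)+V_{l+1}(f(\mathcal X_l,e))\},\qquad G_l(\mathcal X_l)=\Delta R_{\mathrm{tot}}^{(l)}(e_l^\star)+G_{l+1}(f(\mathcal X_l,e_l^\star)),$$ where the greedy edge is $e_l^\star=\arg\max_{e\in\mathcal F_l}\Delta R_{\mathrm{tot}}^{(l)}(e)$, ties broken by enumeration order. Local policy ratio. When $\mathcal F_l\ne\varnothing$ and $k_{\mathrm{rem}}^{(l-1)}\ge1$, $\rho_l\in[0,1]$ is the largest scalar in $[0,1]$ with $\max_{e\in\mathcal F_l}\Delta R_{\mathrm{tot}}^{(l)}(e)\ge\frac{\rho_l}{k_{\mathrm{rem}}^{(l-1)}}V_l(\mathcal X_l)$. In the trajectory statements, the trajectory starts at the given reachable state $\mathcal X_l$, $\rho_t$ is the local policy ratio at $\mathcal X_t$, and ''for all $t$'' ranges over the steps $t\in\{l,\dots,k\}$ of the trajectory. *)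

(* Defs.v *)
From HB Require Import structures.
From mathcomp Require Import all_boot all_order all_algebra.
From mathcomp Require Import all_classical all_reals all_analysis.

Set Implicit Arguments.
Unset Strict Implicit.
Unset Printing Implicit Defensive.

Import Order.TTheory GRing.Theory Num.Theory.
Local Open Scope ring_scope.

(* Edges are two-element sets of nodes.  The candidate edges are enumerated
   without repetition by 'I_p: the index order is the enumeration order used
   for breaking ties, and sets of candidates are sets of indices.  The pair
   (src e, dst e) is the arbitrary orientation of the candidate e. *)
Record instance (R : realType) := Instance {
  n : nat;
  n_gt0 : (0 < n)%N;
  base : {set {set 'I_n}};
  base_card2 : forall e, e \in base -> #|e| = 2%N;
  base_connected :
    forall i j, connect (fun x y : 'I_n => [set x; y] \in base) i j;
  base_weight : {set 'I_n} -> R;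
  base_weight_gt0 : forall e, e \in base -> 0 < base_weight e;
  p : nat;
  src : 'I_p -> 'I_n;
  dst : 'I_p -> 'I_n;
  cand_neq : forall e, src e != dst e;
  cand_inj : injective (fun e => [set src e; dst e]);
  cand_notin_base : forall e, [set src e; dst e] \notin base;
  cost : 'I_p -> R;
  cost_gt0 : forall e, 0 < cost e;
  budget : R;
  budget_gt0 : 0 < budget;
  k : nat;
  k_gt0 : (0 < k)%N;
  wmin : R;
  wmax : R;
  wmin_gt0 : 0 < wmin;
  wmin_le_wmax : wmin <= wmax
}.

Definition harmonic_number (R : realType) (q : nat) : R :=
  \sum_(1 <= j < q.+1) j%:R^-1.

Section Model.
Context {R : realType} {I : instance R}.

Definition base_laplacian : 'M[R]_(n I) :=
  \matrix_(i, j)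
    if i == j then \sum_(e in base I | i \in e) base_weight e
    else if [set i; j] \in base I then - base_weight [set i; j] else 0.

Definition edge_vec (e : 'I_(p I)) : 'cV[R]_(n I) :=
  \col_i ((i == src e)%:R - (i == dst e)%:R).

Record state := State {
  shifted_lap : 'M[R]_(n I);
  remaining : {set 'I_(p I)};
  used : {set 'I_(p I)};
  rem_budget : R
}.

Definition init_state : state :=
  State (base_laplacian + (n I)%:R^-1 *: const_mx 1) [set: 'I_(p I)] finset.set0
    (budget I).

Definition krem (X : state) : nat := (k I - #|used X|)%N.

(* The sum of the m smallest costs over A, counted with multiplicity. *)
Definition smallest_costs (m : nat) (A : {set 'I_(p I)}) : R :=
  \sum_(x <- take m (sort <=%R [seq cost e | e in A])) x.

Definition feasible_instance : Prop :=
  (k I <= p I)%N /\ wmin I * smallest_costs (k I) [set: 'I_(p I)] <= budget I.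

Definition reserve (X : state) (e : 'I_(p I)) : R :=
  wmin I * smallest_costs (krem X).-1 (remaining X :\ e).

Definition actions (X : state) : {set 'I_(p I)} :=
  [set e in remaining X | cost e * wmin I <= rem_budget X - reserve X e].

Definition trial_weight (X : state) (e : 'I_(p I)) : R :=
  Num.min
    (Num.max (wmin I)
       (Num.min (wmax I) (rem_budget X / (krem X)%:R / cost e)))
    ((rem_budget X - reserve X e) / cost e).

Definition eff_res (X : state) (e : 'I_(p I)) : R :=
  ((edge_vec e)^T *m invmx (shifted_lap X) *m edge_vec e) 0 0.

Definition biharm_sq (X : state) (e : 'I_(p I)) : R :=
  \sum_i ((invmx (shifted_lap X) *m edge_vec e) i 0) ^+ 2.

Definition gain (X : state) (e : 'I_(p I)) : R :=
  (n I)%:R * trial_weight X e * biharm_sq X e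
    / (1 + trial_weight X e * eff_res X e).

Definition step (X : state) (e : 'I_(p I)) : state :=
  State (shifted_lap X + trial_weight X e *: (edge_vec e *m (edge_vec e)^T))
    (remaining X :\ e) (e |: used X) (rem_budget X - cost e * trial_weight X e).

Inductive reachable : nat -> state -> Prop :=
| reachable_init : reachable 1 init_state
| reachable_step l X e :
    reachable l X -> e \in actions X -> reachable l.+1 (step X e).

(* Seeding the iterated maximum with a value attained on A makes it the true
   maximum over a nonempty A, whatever the sign of q. *)
Definition max_over (A : {set 'I_(p I)}) (q : 'I_(p I) -> R) : R :=
  if [pick e in A] is Some e0 then \big[Num.max/q e0]_(e in A) q e else 0.

(* [enum] lists indices increasingly, so this is the first maximizer of the
   gain; it is None exactly when there is no feasible action. *)
Definition greedy_edge (X : state) : option 'I_(p I) :=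
  ohead [seq e <- enum (actions X) |
          [forall e' in actions X, gain X e' <= gain X e]].

Definition terminal (X : state) : bool :=
  (actions X == finset.set0) || (krem X == 0%N).

(* The recursions for V and G run on the number k + 1 - l of stages left. *)
Fixpoint V_rec (j : nat) (X : state) : R :=
  if j is j'.+1 then
    if terminal X then 0
    else max_over (actions X) (fun e => gain X e + V_rec j' (step X e))
  else 0.

Definition V (l : nat) (X : state) : R := V_rec ((k I).+1 - l) X.

Fixpoint G_rec (j : nat) (X : state) : R :=
  if j is j'.+1 then
    if terminal X then 0
    else if greedy_edge X is Some e then gain X e + G_rec j' (step X e) else 0
  else 0.

Definition G (l : nat) (X : state) : R := G_rec ((k I).+1 - l) X.

Definition admissible_ratio (l : nat) (X : state) (r : R) : Prop :=
  0 <= r <= 1 /\ r / (krem X)%:R * V l X <= max_over (actions X) (gain X).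

Definition is_policy_ratio (l : nat) (X : state) (r : R) : Prop :=
  admissible_ratio l X r /\ forall r', admissible_ratio l X r' -> r' <= r.

Definition policy_ratio (l : nat) (X : state) : R :=
  xget 0 [set r | is_policy_ratio l X r]%classic.

(* Stationary in the absence of a greedy edge. *)
Definition greedy_step (X : state) : state :=
  if greedy_edge X is Some e then step X e else X.

(* The state at stage t of the greedy trajectory that is at X at stage l. *)
Definition greedy_traj (l : nat) (X : state) (t : nat) : state :=
  iter (t - l) greedy_step X.

End Model.

Arguments state {R} I.
Arguments init_state {R} I.
Arguments feasible_instance {R} I.

(* Main.v *)
(** Every shifted Laplacian met along a trajectory is symmetric positive
    semidefinite, so all one-step gains are nonnegative and the value functions
    are too; the policy ratio is then [min(1, krem * max gain / V)].  The cap in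
    the trial weight always leaves the reserve of the remaining stages
    untouched, so [rem_budget >= wmin * (sum of the krem smallest remaining
    costs)] is invariant, and it makes the cheapest remaining edge feasible.
    The Bellman inequality [V_(l+1) (f X e) <= V_l X - gain e] together with the
    definition of the ratio contracts [V] by [1 - rho/krem] at each greedy step;
    [1 - x <= exp (- x)] turns the product into harmonic numbers. *)
Require Import Defs.
From HB Require Import structures.
From mathcomp Require Import all_boot all_order all_algebra.
From mathcomp Require Import all_classical all_reals all_analysis.
From mathcomp Require Import ring lra zify.

Import Order.TTheory GRing.Theory Num.Theory.
Local Open Scope ring_scope.

(** * Closure properties of positive semidefinite matrices *)

Section PositiveSemidefinite.
Context {R : realType} {n : nat}.
Implicit Types (M N : 'M[R]_n) (x v : 'cV[R]_n).

Definition psd M : Prop :=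
  M^T = M /\ forall x, 0 <= (x^T *m M *m x) 0 0.

Lemma psdD M N : psd M -> psd N -> psd (M + N).
Proof.
move=> [sM pM] [sN pN]; split; first by rewrite linearD /= sM sN.
by move=> x; rewrite mulmxDr mulmxDl mxE addr_ge0.
Qed.

Lemma psdZ (a : R) M : 0 <= a -> psd M -> psd (a *: M).
Proof.
move=> a0 [sM pM]; split; first by rewrite linearZ /= sM.
by move=> x; rewrite -scalemxAr -scalemxAl mxE mulr_ge0.
Qed.

Lemma psd_outer v : psd (v *m v^T).
Proof.
split; first by rewrite trmx_mul trmxK.
move=> x; rewrite mulmxA -mulmxA.
have -> : v^T *m x = (x^T *m v)^T by rewrite trmx_mul trmxK.
by rewrite mxE big_ord1 [X in _ * X]mxE -expr2 sqr_ge0.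
Qed.

(* [invmx M = M] for singular [M], so no invertibility is assumed. *)
Lemma psd_invmx M : psd M -> psd (invmx M).
Proof.
move=> [sM pM]; have [uM|nuM] := boolP (M \in unitmx); last first.
  by rewrite /invmx (negbTE nuM).
split; first by rewrite trmx_inv sM.
move=> x; have := pM (invmx M *m x).
by rewrite trmx_mul trmx_inv sM mulmxA mulmxKV.
Qed.

End PositiveSemidefinite.

(** * The quadratic form of the base Laplacian *)

Section Laplacian.
Context {R : realType} {I : instance R}.

Let W (i j : 'I_(n I)) : R :=
  if [set i; j] \in base I then base_weight [set i; j] else 0.

Let WC i j : W i j = W j i.
Proof. by rewrite /W finset.setUC. Qed.

Let Wii i : W i i = 0.
Proof.
rewrite /W; case: ifP => // /base_card2.
by rewrite finset.setUid cards1.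
Qed.

Let W_ge0 i j : 0 <= W i j.
Proof. by rewrite /W; case: ifP => // /base_weight_gt0/ltW. Qed.

(** A base edge containing [i] is [[set i; j]] for a single [j], recovered by picking in [e :\ i].
    Since base edges have two elements, the default of [odflt] is never reached on them. *)
Let degreeE i : \sum_(e in base I | i \in e) base_weight e = \sum_j W i j.
Proof.
rewrite /W -big_mkcond /=.
rewrite (reindex_onto (fun j => [set i; j])
  (fun e : {set 'I_(n I)} => odflt i [pick j in e :\ i])) /=; last first.
  move=> e /andP[/base_card2/eqP /cards2P[a [b [ab ->]]]].
  rewrite !inE => /orP[/eqP ->|/eqP ->].
    have -> : [set a; b] :\ a = [set b].
      by apply/setP => z; rewrite !inE; case: (eqVneq z a) => [->|] //=; rewrite (negbTE ab).
    by case: pickP => [z /set1P ->|/(_ b)] //; rewrite set11.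
  have -> : [set a; b] :\ b = [set a].
    apply/setP => z; rewrite !inE; case: (eqVneq z b) => [->|] //=; last by rewrite orbF.
    by rewrite eq_sym (negbTE ab).
  case: pickP => [z /set1P ->|/(_ a)]; last by rewrite set11.
  by rewrite /= finset.setUC.
apply: eq_bigl => j; rewrite set21 andbT; apply: andb_idr => /base_card2.
rewrite cards2 => /eqP; case: (eqVneq i j) => // ij _.
have -> : [set i; j] :\ i = [set j].
  by apply/setP => z; rewrite !inE; case: (eqVneq z i) => [->|] //=; rewrite (negbTE ij).
by case: pickP => [z /set1P -> /=|/(_ j)] //; rewrite set11.
Qed.

Let laplacianE i j :
  (base_laplacian : 'M[R]_(n I)) i j = (i == j)%:R * (\sum_h W i h) - W i j.
Proof.
rewrite mxE degreeE; case: eqVneq => [<-|ij]; first by rewrite Wii mul1r subr0.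
by rewrite mul0r sub0r /W; case: ifP; rewrite ?oppr0.
Qed.

Lemma psd_base_laplacian : psd (base_laplacian : 'M[R]_(n I)).
Proof.
split.
  apply/matrixP => i j; rewrite mxE !laplacianE WC eq_sym.
  by case: eqVneq => [->|] //; rewrite !mul0r.
move=> x; pose y i := x i 0.
have -> : (x^T *m base_laplacian *m x) 0 0
    = \sum_i \sum_j W i j * (y i ^+ 2 - y i * y j).
  transitivity (\sum_i y i * \sum_j base_laplacian i j * y j).
    rewrite -mulmxA mxE; apply: eq_bigr => i _; rewrite !mxE.
    by congr (_ * _); apply: eq_bigr => j _.
  apply: eq_bigr => i _.
  have -> : \sum_j base_laplacian i j * y j = \sum_j W i j * (y i - y j).
    under eq_bigr => j _ do rewrite laplacianE mulrBl.
    under [RHS]eq_bigr => j _ do rewrite mulrBr.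
    rewrite !big_split /=; congr (_ + _).
    rewrite -mulr_suml; set D := \sum_h W i h.
    rewrite (bigD1 i) //= eqxx mul1r big1 ?addr0 // => j ji.
    by rewrite eq_sym (negbTE ji) !mul0r.
  by rewrite mulr_sumr; apply: eq_bigr => j _; ring.
set S := (X in 0 <= X).
(* Exchanging the indices in one copy of [S] completes the square and avoids choosing one order for
   each pair. *)
have SE : S + S = \sum_i \sum_j W i j * (y i - y j) ^+ 2.
  rewrite {2}/S exchange_big /S -big_split /=; apply: eq_bigr => i _.
  rewrite -big_split /=; apply: eq_bigr => j _.
  by rewrite (WC j i); ring.
suff : 0 <= S + S by lra.
by rewrite SE; do 2!apply: sumr_ge0 => ? _; rewrite mulr_ge0 ?sqr_ge0.
Qed.

End Laplacian.

(** * Maxima over nonempty sets of candidates *)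

Section Maximum.
Context {R : realType} {I : instance R}.
Implicit Types (A : {set 'I_(p I)}) (q : 'I_(p I) -> R) (e : 'I_(p I)).

Lemma max_over_ge A q e : e \in A -> q e <= max_over A q.
Proof.
move=> eA; rewrite /max_over; case: pickP => [e0 _|/(_ e)]; last by rewrite eA.
exact: le_bigmax_cond.
Qed.

Lemma max_over_attained A q :
  A != finset.set0 -> exists2 e, e \in A & max_over A q = q e.
Proof.
move=> /set0Pn[e1 e1A]; rewrite /max_over.
case: pickP => [e0 e0A|/(_ e1)]; last by rewrite e1A.
(* Being a value of [q] on [A] holds for the seed and is stable under binary maximum. *)
apply: (big_ind (fun v => exists2 e, e \in A & v = q e)) => [|v w|e eA].
- by exists e0.
- by move=> [a aA ->] [b bA ->]; rewrite maxEle; case: ifP; [exists b|exists a].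
- by exists e.
Qed.

End Maximum.

(** * Harmonic numbers *)

Lemma harmonic_numberS (R : realType) q :
  harmonic_number R q.+1 = harmonic_number R q + q.+1%:R^-1.
Proof. by rewrite /harmonic_number big_nat_recr. Qed.

(** A telescoping sum. For [K = k I], the term at [t] will be the reciprocal of [krem] at stage
    [t]. *)
Lemma harmonic_number_diff (R : realType) (K l m : nat) : (l <= m <= K)%N ->
  harmonic_number R (K - l + 1) - harmonic_number R (K - m)
    = \sum_(l <= t < m.+1) (K - t).+1%:R^-1.
Proof.
move=> /andP[lm]; rewrite -(subnKC lm); move: (m - l)%N => d {lm m}.
elim: d => [|d IH] dK.
  by rewrite addn0 big_nat1 addn1 harmonic_numberS addrAC subrr add0r.
rewrite addnS in dK *.
rewrite big_nat_recr /= ?leqW ?leq_addr // -IH ?(ltnW dK) //.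
rewrite -[(K - (l + d))%N]subnSK // harmonic_numberS.
by rewrite opprD addrA subrK.
Qed.

(** * Gains, value functions and the invariant of transitions *)

Section Dynamics.
Context {R : realType} {I : instance R}.
Implicit Types (X : state I) (e : 'I_(p I)) (A : {set 'I_(p I)}).

(** Take [e] of least cost: its cost followed by the sorted costs of [A :\ e] is a sorted
    permutation of the costs of [A], and such a list is unique. In this way the budget invariant
    splits into the cost of an edge and its reserve. *)
Lemma smallest_costs_pop A m : A != finset.set0 ->
  exists2 e, e \in A & smallest_costs m.+1 A = cost e + smallest_costs m (A :\ e).
Proof.
move=> /set0Pn[e1 e1A].
case: (arg_minP (fun e => cost e) e1A) => e eA emin; exists e => //.
rewrite /smallest_costs.
suff -> : sort <=%R [seq cost x | x in A]
    = cost e :: sort <=%R [seq cost x | x in A :\ e] by rewrite /= big_cons.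
apply: (sorted_eq (@le_trans _ _) (@le_anti _ _)).
- exact/sort_sorted/le_total.
- rewrite /= path_min_sorted; first exact/sort_sorted/le_total.
  rewrite all_sort; apply/allP => _ /mapP[x + ->]; rewrite mem_enum => /setD1P[_]; exact: emin.
- rewrite perm_sort -[X in perm_eq _ X]cat1s.
  apply: (@perm_trans _ ([:: cost e] ++ [seq cost x | x in A :\ e])); last first.
    by rewrite perm_cat2l perm_sym perm_sort.
  rewrite -[_ ++ _]/(map (@cost R I) (e :: enum (A :\ e))); apply: perm_map.
  apply: uniq_perm; first exact: enum_uniq.
    by rewrite /= enum_uniq mem_enum setD11.
  move=> x; rewrite inE !mem_enum !inE.
  by case: eqVneq => [->|].
Qed.

Lemma actions_remaining {X e} : e \in actions X -> e \in remaining X.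
Proof. by rewrite inE => /andP[]. Qed.

(** Feasibility of [e] says precisely that the reserve cap is at least [wmin I]. *)
Lemma trial_weight_ge_wmin X e : e \in actions X -> wmin I <= trial_weight X e.
Proof.
rewrite inE => /andP[_ he].
by rewrite /trial_weight le_min le_max lexx /= ler_pdivlMr ?cost_gt0 // mulrC.
Qed.

Lemma step_budget_ge_reserve X e : reserve X e <= rem_budget (step X e).
Proof.
rewrite /= lerBrDl -lerBrDr mulrC -ler_pdivlMr ?cost_gt0 //.
by rewrite /trial_weight ge_min lexx orbT.
Qed.

Lemma trial_weight_ge0 X e : e \in actions X -> 0 <= trial_weight X e.
Proof.
by move=> /trial_weight_ge_wmin; apply: le_trans; exact/ltW/wmin_gt0.
Qed.

Lemma gain_ge0 X e :
  psd (shifted_lap X) -> e \in actions X -> 0 <= gain X e.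
Proof.
move=> /psd_invmx[_ pX] /trial_weight_ge0 w0; rewrite /gain divr_ge0 //.
  by rewrite !mulr_ge0 // sumr_ge0 // => i _; exact: sqr_ge0.
by rewrite addr_ge0 // mulr_ge0 // /eff_res.
Qed.

Lemma psd_step X e :
  psd (shifted_lap X) -> e \in actions X -> psd (shifted_lap (step X e)).
Proof.
move=> pX /trial_weight_ge0 w0; apply: psdD => //.
exact/psdZ/psd_outer.
Qed.

Lemma greedy_edgeP X : actions X != finset.set0 ->
  exists e, [/\ greedy_edge X = Some e, e \in actions X
                & gain X e = max_over (actions X) (gain X)].
Proof.
move=> A0; rewrite /greedy_edge; set s := seq.filter _ _.
have sP e : e \in s -> e \in actions X /\ gain X e = max_over (actions X) (gain X).
  rewrite mem_filter mem_enum => /andP[/forall_inP he eA]; split=> //.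
  apply/eqP; rewrite eq_le max_over_ge //=.
  by have [e' /he + ->] := max_over_attained _ (gain X) A0.
case Es: s sP => [|e s'] sP; last first.
  by exists e; have [eA ge] := sP e (mem_head e s').
(* An attained maximum survives the filter, so the list of maximizers cannot be empty. *)
have [e eA ge] := max_over_attained _ (gain X) A0.
suff : e \in s by rewrite Es.
rewrite mem_filter mem_enum eA andbT.
by apply/forall_inP => e' e'A; rewrite -ge max_over_ge.
Qed.

Lemma greedy_edge_actions X e : greedy_edge X = Some e -> e \in actions X.
Proof.
rewrite /greedy_edge; set s := seq.filter _ _ => hs.
have : e \in s by case: s hs => //= a s [->]; rewrite mem_head.
by rewrite mem_filter mem_enum => /andP[].
Qed.

Lemma V_rec_ge0 j X : psd (shifted_lap X) -> 0 <= V_rec j X.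
Proof.
elim: j X => [|j IH] X pX //=; case: ifPn => // /norP[A0 _].
have [e eA ->] := max_over_attained _ (fun e => gain X e + V_rec j (step X e)) A0.
by rewrite addr_ge0 ?gain_ge0 // IH //; exact: psd_step.
Qed.

(** The greedy edge is one of the choices in the maximum defining [V_rec], and its continuation is
    bounded by induction. *)
Lemma G_rec_bounds j X : psd (shifted_lap X) -> 0 <= G_rec j X <= V_rec j X.
Proof.
elim: j X => [|j IH] X pX /=; first by rewrite lexx.
case: ifPn => [_|/norP[A0 _]]; first by rewrite lexx.
have [e [-> eA _]] := greedy_edgeP _ A0.
have /andP[G0 GV] := IH _ (psd_step _ _ pX eA).
rewrite addr_ge0 ?gain_ge0 //=.
have := max_over_ge _ (fun e => gain X e + V_rec j (step X e)) _ eA.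
by apply: le_trans; rewrite lerD2l.
Qed.

(** Admissibility of [r] reads [r * c <= m] with [c] the value divided by [krem]. This has a largest
    solution in the unit interval, so [xget] does not fall back on its default. *)
Lemma policy_ratioP l X : psd (shifted_lap X) -> actions X != finset.set0 ->
  is_policy_ratio l X (policy_ratio l X).
Proof.
move=> pX A0; suff [r hr] : exists r, is_policy_ratio l X r.
  by rewrite /policy_ratio; case: xgetP => [? _ //|/(_ r)].
have V0 : 0 <= V l X by exact: V_rec_ge0.
have m0 : 0 <= max_over (actions X) (gain X).
  by have [e eA ->] := max_over_attained _ (gain X) A0; exact: gain_ge0.
set m := max_over _ _ in m0 *.
set c : R := (krem X)%:R^-1 * V l X.
have cE r : r / (krem X)%:R * V l X = r * c by rewrite /c mulrA.
have c0 : 0 <= c by rewrite mulr_ge0 ?invr_ge0.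
rewrite /is_policy_ratio /admissible_ratio -/m.
(* If [c] vanishes, every ratio in the unit interval is admissible and the largest is 1. *)
have [cz|cnz] := eqVneq c 0.
  exists 1; split; first by rewrite cE cz mulr0 ler01 lexx.
  by move=> r [/andP[]].
have cp : 0 < c by rewrite lt_def cnz.
exists (Num.min 1 (m / c)); split.
  rewrite cE le_min ler01 divr_ge0 //= ge_min lexx /=; split=> //.
  by rewrite -ler_pdivlMr // ge_min lexx orbT.
by move=> r [/andP[_ r1]]; rewrite cE -ler_pdivlMr // le_min r1.
Qed.

(** Initially the budget bound is feasibility of the instance. After a step the sum has one term
    fewer and ranges over [remaining X :\ e], which is the sum in [reserve X e]. *)
Lemma reachable_invariant l X : feasible_instance I -> reachable l X ->
  (l <= (k I).+1)%N ->
  [/\ (0 < l)%N, psd (shifted_lap X), krem X = (k I - l.-1)%N,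
      remaining X = ~: used X /\ #|used X| = l.-1
    & wmin I * smallest_costs (krem X) (remaining X) <= rem_budget X].
Proof.
move=> [kp hC]; elim=> {l X} [_|l X e _ IH eA lk]; last first.
  have [l0 pX kE [rE uE] _] := IH (ltnW lk).
  have eu : e \notin used X by rewrite -finset.in_setC -rE actions_remaining.
  have uE' : #|e |: used X| = l by rewrite cardsU1 eu uE add1n prednK.
  have kE' : krem (step X e) = (k I - l)%N by rewrite /krem /= uE'.
  split=> //; first exact: psd_step.
    by split=> //; rewrite /= rE; apply/setP => z; rewrite !inE negb_or.
  have -> : krem (step X e) = (krem X).-1 by rewrite kE' kE; lia.
  exact: step_budget_ge_reserve.
split=> //; rewrite /krem /= ?cards0 ?subn0 //.
  apply: psdD; first exact: psd_base_laplacian.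
  apply: psdZ; first by rewrite invr_ge0.
  have -> : const_mx 1 = const_mx 1 *m (const_mx 1 : 'cV[R]_(n I))^T :> 'M[R]_(n I).
    by apply/matrixP => i j; rewrite !mxE big_ord1 !mxE mulr1.
  exact: psd_outer.
by rewrite finset.setC0.
Qed.

(** * Contraction along the greedy trajectory of a feasible instance *)

Section Reachable.
Hypothesis feas : feasible_instance I.

Lemma reachable_psd l X :
  (l <= k I)%N -> reachable l X -> psd (shifted_lap X).
Proof. by move=> lk hX; have [] := reachable_invariant _ _ feas hX (leqW lk). Qed.

Lemma reachable_krem l X :
  (l <= k I)%N -> reachable l X -> krem X = (k I - (l - 1))%N.
Proof.
by move=> lk hX; have [_ _ ->] := reachable_invariant _ _ feas hX (leqW lk); rewrite subn1.
Qed.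

Lemma reachable_krem_gt0 l X : (l <= k I)%N -> reachable l X -> (0 < krem X)%N.
Proof.
move=> lk hX; rewrite (reachable_krem _ _ lk hX).
by have [] := reachable_invariant _ _ feas hX (leqW lk); lia.
Qed.

(** Fewer than [k I <= p I] edges are used, so some edge remains. For the cheapest one, the budget
    invariant is its cost times [wmin I] plus its reserve, which is the feasibility test. *)
Lemma reachable_actions l X :
  (l <= k I)%N -> reachable l X -> actions X != finset.set0.
Proof.
move=> lk hX; have := reachable_krem_gt0 _ _ lk hX.
have [l0 _ kE [rE uE] hb] := reachable_invariant _ _ feas hX (leqW lk).
have rem0 : remaining X != finset.set0.
  rewrite -card_gt0 rE cardsCs finset.setCK card_ord uE.
  by have [kp _] := feas; lia.
case E : (krem X) hb => [//|m] hb _.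
have [e er eE] := smallest_costs_pop _ m rem0.
apply/set0Pn; exists e; rewrite inE er /=.
rewrite /reserve E /= lerBrDr mulrC -mulrDr -eE.
exact: hb.
Qed.

Lemma greedy_contraction l X : (l <= k I)%N -> reachable l X ->
  exists2 e, greedy_edge X = Some e &
    policy_ratio l X / (krem X)%:R * V l X <= gain X e /\
    V l.+1 (step X e) <= (1 - policy_ratio l X / (krem X)%:R) * V l X.
Proof.
move=> lk hX.
have A0 := reachable_actions _ _ lk hX; have k0 := reachable_krem_gt0 _ _ lk hX.
have [e [he eA ge]] := greedy_edgeP _ A0; exists e => //.
have [[_ hr] _] := policy_ratioP l _ (reachable_psd _ _ lk hX) A0.
rewrite ge; split=> //; rewrite mulrBl mul1r lerBrDr.
apply: le_trans (_ : gain X e + V l.+1 (step X e) <= _); first by rewrite addrC lerD2r ge.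
(* As [l <= k I], at least one stage is left and the Bellman recursion unfolds once. *)
rewrite /V subSS subSn // /= /terminal (negbTE A0) /= -[krem X == 0%N]negbK -lt0n k0.
exact: (max_over_ge _ (fun e => gain X e + V_rec (k I - l) (step X e))).
Qed.

(** The ratio is at most 1 and [krem] at least 1. The sign is what allows the one-step inequalities
    to be multiplied. *)
Lemma contraction_factor_bounds l X : (l <= k I)%N -> reachable l X ->
  0 <= 1 - policy_ratio l X / (krem X)%:R.
Proof.
move=> lk hX; have k0 := reachable_krem_gt0 _ _ lk hX.
have [[/andP[_ r1] _] _] :=
  policy_ratioP l _ (reachable_psd _ _ lk hX) (reachable_actions _ _ lk hX).
rewrite subr_ge0 ler_pdivrMr ?ltr0n // mul1r (le_trans r1) //.
by rewrite ler1n.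
Qed.

Lemma greedy_trajS l X t :
  (l <= t)%N -> greedy_traj l X t.+1 = greedy_step (greedy_traj l X t).
Proof. by move=> lt; rewrite /greedy_traj subSn. Qed.

(** Each step taken starts at a stage at most [k I], where an action exists, so [greedy_step] is a
    genuine transition. *)
Lemma greedy_traj_reachable l X t : reachable l X -> (l <= t <= (k I).+1)%N ->
  reachable t (greedy_traj l X t).
Proof.
move=> hX /andP[lt]; rewrite -(subnKC lt); move: (t - l)%N => d {lt t}.
elim: d => [|d IH] dk; first by rewrite addn0 /greedy_traj subnn.
rewrite addnS in dk *; have hY := IH (ltnW dk).
rewrite greedy_trajS ?leq_addr // /greedy_step.
have [e' [-> e'A _]] := greedy_edgeP _ (reachable_actions _ _ dk hY).
exact: reachable_step.
Qed.

Lemma greedy_traj_contraction l X t : reachable l X -> (l <= t <= k I)%N ->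
  V t.+1 (greedy_traj l X t.+1) <=
    (1 - policy_ratio t (greedy_traj l X t) / (krem (greedy_traj l X t))%:R)
      * V t (greedy_traj l X t).
Proof.
move=> hX /andP[lt tk].
have hY : reachable t (greedy_traj l X t).
  by apply: greedy_traj_reachable => //; rewrite lt leqW.
rewrite greedy_trajS // /greedy_step.
by have [e -> []] := greedy_contraction _ _ tk hY.
Qed.

Lemma greedy_traj_product l X m : reachable l X -> (l <= m <= k I)%N ->
  V m.+1 (greedy_traj l X m.+1) <=
    (\prod_(l <= t < m.+1)
       (1 - policy_ratio t (greedy_traj l X t)
              / (krem (greedy_traj l X t))%:R)) * V l X.
Proof.
move=> hX /andP[lm]; rewrite -(subnKC lm); move: (m - l)%N => d {lm m}.
elim: d => [|d IH] dk.
  rewrite addn0 in dk *; rewrite big_nat1.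
  have := greedy_traj_contraction l X l hX.
  by rewrite /greedy_traj subnn leqnn dk; exact.
rewrite addnS in dk *; set m := (l + d)%N in dk IH *.
have lm : (l <= m)%N by exact: leq_addr.
rewrite big_nat_recr ?leqW //= mulrAC mulrC.
apply: le_trans (greedy_traj_contraction _ _ _ hX _) _; first by rewrite leqW.
apply: ler_wpM2l; last exact: IH (ltnW dk).
apply: contraction_factor_bounds => //.
by apply: greedy_traj_reachable => //; rewrite !leqW // ltnW.
Qed.

Lemma greedy_traj_harmonic l X m rho_min : reachable l X -> (l <= m <= k I)%N ->
  (forall t, (l <= t <= k I)%N ->
     rho_min <= policy_ratio t (greedy_traj l X t)) ->
  V m.+1 (greedy_traj l X m.+1) <=
    expR (- rho_min * (harmonic_number R (k I - l + 1)
                       - harmonic_number R (k I - m))) * V l X.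
Proof.
move=> hX /andP[lm mk] hrho.
have V0 : 0 <= V l X.
  exact/V_rec_ge0/(reachable_psd _ _ (leq_trans lm mk) hX).
apply: le_trans (greedy_traj_product _ _ _ hX _) _; first by rewrite lm.
apply: ler_wpM2r => //.
have -> : harmonic_number R (k I - l + 1) - harmonic_number R (k I - m)
    = \sum_(l <= t < m.+1) (k I - t).+1%:R^-1.
  by rewrite harmonic_number_diff // lm.
rewrite mulr_sumr expR_sum !big_nat.
(* The exponential of the sum is now a product, compared factor by factor. *)
apply: ler_prod => t /andP[lt tm]; have tk : (t <= k I)%N by lia.
have hY : reachable t (greedy_traj l X t).
  by apply: greedy_traj_reachable => //; rewrite lt leqW.
rewrite contraction_factor_bounds //=.
have [t0 _ _ _ _] := reachable_invariant _ _ feas hY (leqW tk).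
(* Stages start at 1, so [0 < t] and truncated subtraction is harmless here. *)
rewrite (reachable_krem _ _ tk hY) (_ : (k I - (t - 1) = (k I - t).+1)%N); last by lia.
apply: le_trans (expR_ge1Dx _); rewrite lerD2l mulNr lerN2.
by rewrite ler_wpM2r ?invr_ge0 // hrho // lt.
Qed.

End Reachable.
End Dynamics.

Theorem theorem5 (R : realType) (I : instance R) (hfeas : feasible_instance I)
    (l : nat) (hl : (1 <= l <= k I)%N) (X : state I) (hX : reachable l X) :
  actions X != finset.set0 /\ (1 <= krem X)%N /\
  is_policy_ratio l X (policy_ratio l X) /\
  (exists2 e : 'I_(p I), greedy_edge X = Some e &
     policy_ratio l X / (krem X)%:R * V l X <= gain X e /\
     V l.+1 (step X e) <= (1 - policy_ratio l X / (krem X)%:R) * V l X) /\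
  0 <= G l X <= V l X /\
  (forall m : nat, (l <= m <= k I)%N ->
     V m.+1 (greedy_traj l X m.+1) <=
       (\prod_(l <= t < m.+1)
          (1 - policy_ratio t (greedy_traj l X t)
                 / (krem (greedy_traj l X t))%:R)) * V l X) /\
  (forall rho_min : R, 0 < rho_min ->
     (forall t : nat, (l <= t <= k I)%N ->
        rho_min <= policy_ratio t (greedy_traj l X t)) ->
     (forall t : nat, (l <= t <= k I)%N ->
        krem (greedy_traj l X t) = (k I - (t - 1))%N) /\
     (forall m : nat, (l <= m <= k I)%N ->
        V m.+1 (greedy_traj l X m.+1) <=
          expR (- rho_min * (harmonic_number R (k I - l + 1)
                             - harmonic_number R (k I - m))) * V l X)).

Proof.
have /andP[_ lk] := hl.
have A0 := reachable_actions hfeas _ _ lk hX.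
have pX := reachable_psd hfeas _ _ lk hX.
split=> //; split; first exact: reachable_krem_gt0 hX.
split; first exact: policy_ratioP.
split; first exact: greedy_contraction.
split; first exact: G_rec_bounds.
split=> [m|rho_min _ hrho]; first exact: greedy_traj_product.
split=> [t /andP[lt tk]|m hm]; last exact: greedy_traj_harmonic.
apply: reachable_krem => //.
by apply: greedy_traj_reachable => //; rewrite lt leqW.
Qed.
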